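(* Let $K\subseteq Q$ be a convex cone and let $r$ be an integer with $0\le r\le d$. Then $N_+^r(K)\subseteq N^r(K)\subseteq N_0^r(K)\subseteq \tilde N_0^r(K)$, where $$\tilde N_0^r(K)=\bigcap_{J\subseteq\{1,\dots,d\},\,|J|=r}\ \sum_{(J_0,J_1)\text{ partition of }J}\Big(K\cap\{x: x_i=0\text{ for } i\in J_0,\ x_i=x_0\text{ for } i\in J_1\}\Big).$$
   Context: Let $d\ge 1$. Vectors in $\mathbb{R}^{d+1}$ have coordinates indexed $0,1,\dots,d$ and are written $(x_0,x)$; $e_j$ is the $j$-th unit vector. $Q\subseteq\mathbb{R}^{d+1}$ is the convex cone generated by all vectors $(1,x)$ with $x\in\{0,1\}^d$. For a convex cone $C$, $C^*=\{s: s^Tx\ge 0\ \forall x\in C\}$. For a convex cone $K\subseteq Q$: $M(K)$ is the set of real symmetric $(d+1)\times(d+1)$ matrices $Y$ with $Ye_0=\mathrm{diag}(Y)$ and $u^TYv\ge 0$ for all $u\in Q^*$, $v\in K^*$; $M_+(K)$ is the set of positive semidefinite members of $M(K)$; $N(K)=\{\mathrm{diag}(Y):Y\in M(K)\}$, $N_+(K)=\{\mathrm{diag}(Y):Y\in M_+(K)\}$; $N_0(K)=\bigcap_{i=1}^d\big[(K\cap\{x:x_i=0\})+(K\cap\{x:x_i=x_0\})\big]$. Iterates: $N^0(K)=K$, $N^r(K)=N(N^{r-1}(K))$, and similarly for $N_+^r$, $N_0^r$. The sum of sets is the Minkowski sum.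
   Formalization: The middle inclusion N^r(K) ⊆ N_0^r(K) is stated for closed K only; it fails in general, e.g. d=1, r=1, K={0}∪{0<x_1<x_0}, where N(K)=Q but N_0(K)={0}. *)

(* Defs.v *)
From mathcomp Require Import all_boot all_order all_algebra.
From mathcomp Require Import all_classical all_reals all_analysis.

Set Implicit Arguments.
Unset Strict Implicit.
Unset Printing Implicit Defensive.

Import Order.TTheory GRing.Theory Num.Theory.
Import numFieldNormedType.Exports.

Local Open Scope classical_set_scope.
Local Open Scope ring_scope.

(* R^(d+1) is 'cV[R]_d.+1: coordinate 0 is [ord0], and the coordinates
   1, ..., d are [lift ord0 i] for i : 'I_d; subsets of {1, ..., d} are
   therefore elements of {set 'I_d}. *)
Definition coord (R : realType) (d : nat) (x : 'cV[R]_d.+1) (i : 'I_d) : R :=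
  x (lift ord0 i) ord0.

Definition coord0 (R : realType) (d : nat) (x : 'cV[R]_d.+1) : R :=
  x ord0 ord0.

Definition convex_cone (R : realType) (n : nat) (K : set 'cV[R]_n) : Prop :=
  [/\ K 0,
      forall x y, K x -> K y -> K (x + y) &
      forall (a : R) x, 0 <= a -> K x -> K (a *: x)].

Definition cone_hull (R : realType) (n : nat) (G : set 'cV[R]_n) :
    set 'cV[R]_n :=
  smallest (@convex_cone R n) G.

Definition dual_cone (R : realType) (n : nat) (C : set 'cV[R]_n) :
    set 'cV[R]_n :=
  [set s | forall x, C x -> 0 <= (s^T *m x) ord0 ord0].

Definition Qcone (R : realType) (d : nat) : set 'cV[R]_d.+1 :=
  cone_hull [set z | coord0 z = 1 /\
                     forall i : 'I_d, coord z i = 0 \/ coord z i = 1].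

Definition unit_vec (R : realType) (d : nat) (j : 'I_d.+1) : 'cV[R]_d.+1 :=
  delta_mx j ord0.

Definition diag_vec (R : realType) (n : nat) (Y : 'M[R]_n) : 'cV[R]_n :=
  \col_i Y i i.

Definition psd (R : realType) (n : nat) (Y : 'M[R]_n) : Prop :=
  Y^T = Y /\ forall x : 'cV[R]_n, 0 <= (x^T *m Y *m x) ord0 ord0.

Definition M_LS (R : realType) (d : nat) (K : set 'cV[R]_d.+1) :
    set 'M[R]_d.+1 :=
  [set Y | [/\ Y^T = Y,
               Y *m unit_vec R ord0 = diag_vec Y &
               forall u v, dual_cone (@Qcone R d) u -> dual_cone K v ->
                 0 <= (u^T *m Y *m v) ord0 ord0]].

Definition Mplus_LS (R : realType) (d : nat) (K : set 'cV[R]_d.+1) :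
    set 'M[R]_d.+1 :=
  [set Y | M_LS K Y /\ psd Y].

Definition N_LS (R : realType) (d : nat) (K : set 'cV[R]_d.+1) :
    set 'cV[R]_d.+1 :=
  [set diag_vec Y | Y in M_LS K].

Definition Nplus_LS (R : realType) (d : nat) (K : set 'cV[R]_d.+1) :
    set 'cV[R]_d.+1 :=
  [set diag_vec Y | Y in Mplus_LS K].

Definition minkowski_add (R : realType) (n : nat) (A B : set 'cV[R]_n) :
    set 'cV[R]_n :=
  [set x + y | x in A & y in B].

Definition minkowski_sum (R : realType) (n : nat) (I : finType) (P : pred I)
    (A : I -> set 'cV[R]_n) : set 'cV[R]_n :=
  [set x | exists2 f : I -> 'cV[R]_n,
             (forall i, P i -> A i (f i)) & x = \sum_(i | P i) f i].

Definition N0_LS (R : realType) (d : nat) (K : set 'cV[R]_d.+1) :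
    set 'cV[R]_d.+1 :=
  \bigcap_(i in [set: 'I_d])
    minkowski_add (K `&` [set x | coord x i = 0])
                  (K `&` [set x | coord x i = coord0 x]).

(* The two parts are ordered and may be empty. *)
Definition is_bipartition (d : nat) (J : {set 'I_d})
    (P : {set 'I_d} * {set 'I_d}) : bool :=
  (P.1 :|: P.2 == J) && [disjoint P.1 & P.2].

Definition face01 (R : realType) (d : nat) (P : {set 'I_d} * {set 'I_d}) :
    set 'cV[R]_d.+1 :=
  [set x | (forall i, i \in P.1 -> coord x i = 0) /\
           (forall i, i \in P.2 -> coord x i = coord0 x)].

Definition N0tilde_LS (R : realType) (d r : nat) (K : set 'cV[R]_d.+1) :
    set 'cV[R]_d.+1 :=
  \bigcap_(J in [set J : {set 'I_d} | #|J| = r])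
    minkowski_sum (is_bipartition J) (fun P => K `&` @face01 R d P).

(* Main.v *)
(* For the second inclusion, closedness of the cone is what makes N(L) a subset
   of N_0(L): by the bipolar theorem Y e_i and Y (e_0 - e_i) lie in L, and they
   split diag(Y) = Y e_0 along the faces x_i = x_0 and x_i = 0.  To iterate, N(L)
   must again be closed, which holds because diag is a proper map on M(L) when
   L is contained in Q.  For the third, if x = y + z with y_i = 0 and z_i = z_0,
   and y, z are decomposed over the partitions of J \ {i}, then every summand of
   y has i-th coordinate 0 and every summand g of z has g_i = g_0, since on Q
   the quantities x_i and x_0 - x_i are nonnegative. *)

Require Import Defs.
From mathcomp Require Import all_boot all_order all_algebra.
From mathcomp Require Import all_classical all_reals all_analysis.
From mathcomp Require Import ring lra.

Set Implicit Arguments.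
Unset Strict Implicit.
Unset Printing Implicit Defensive.

Import Order.TTheory GRing.Theory Num.Theory.
Import numFieldNormedType.Exports.

Local Open Scope classical_set_scope.
Local Open Scope ring_scope.

(** * Continuity, compactness and closedness for matrices *)

Lemma continuous_mx (T : topologicalType) (R : realType) (m n : nat)
    (f : T -> 'M[R]_(m, n)) :
  (forall i j, continuous (fun t => f t i j)) -> continuous f.
Proof.
move=> cf t A [P Pt sPA]; rewrite /nbhs /=.
(* A matrix neighbourhood contains an entrywise product of neighbourhoods, and there are only
   finitely many entries to control. *)
apply: (@filterS _ _ _ [set s | forall i j, P i j (f s i j)]).
  by move=> s Ps; apply: sPA.
by do 2![apply: filter_forall => ?]; apply: cf; apply: Pt.
Qed.

Lemma continuous_mx_entry (T : topologicalType) (R : realType) (m n : nat)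
    (f : T -> 'M[R]_(m, n)) i j :
  continuous f -> continuous (fun t => f t i j).
Proof.
move=> cf t.
exact: (continuous_comp (g := fun M : 'M[R]_(m, n) => M i j) (cf t)
          (@coord_continuous _ _ _ _ _ _)).
Qed.

Lemma continuous_mulmx (T : topologicalType) (R : realType) (m n p : nat)
    (f : T -> 'M[R]_(m, n)) (g : T -> 'M[R]_(n, p)) :
  continuous f -> continuous g -> continuous (fun t => f t *m g t).
Proof.
move=> cf cg; apply: continuous_mx => i j.
rewrite (_ : (fun t => _) = fun t => \sum_k f t i k * g t k j); last first.
  by apply/funext => t; rewrite mxE.
apply: continuous_big => [|k _]; first exact: add_continuous.
by move=> t; apply: cvgM; apply: continuous_mx_entry.
Qed.

Lemma continuous_trmx (T : topologicalType) (R : realType) (m n : nat)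
    (f : T -> 'M[R]_(m, n)) :
  continuous f -> continuous (fun t => (f t)^T).
Proof.
move=> cf; apply: continuous_mx => i j.
rewrite (_ : (fun t => _) = fun t => f t j i); first exact: continuous_mx_entry.
by apply/funext => t; rewrite mxE.
Qed.

Lemma continuous_diag_vec (R : realType) (n : nat) :
  continuous (@diag_vec R n).
Proof.
apply: continuous_mx => i j.
rewrite (_ : (fun t => _) = fun Y : 'M[R]_n => Y i i).
  exact: coord_continuous.
by apply/funext => t; rewrite mxE.
Qed.

(** The box is the image under the continuous map [vec_mx] of a product of segments, which is
    compact in row-vector space. *)
Lemma mx_box_compact (R : realType) (m n : nat) (c : R) :
  compact [set Y : 'M[R]_(m, n) | forall i j, `|Y i j| <= c].
Proof.
rewrite (_ : mkset _ = vec_mx @`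
    [set v : 'rV[R]_(m * n) | forall k, `[- c, c]%classic (v ord0 k)]).
  apply: continuous_compact; last first.
    apply: (@rV_compact R _ (fun=> `[- c, c]%classic)) => _.
    exact: segment_compact.
  apply: continuous_subspaceT; apply: continuous_mx => i j.
  rewrite (_ : (fun t => _) =
               fun v : 'rV[R]_(m * n) => v ord0 (mxvec_index i j)).
    exact: coord_continuous.
  by apply/funext => v; rewrite -[in RHS](vec_mxK v) mxvecE.
apply/seteqP; split=> [Y Yc|_ [v vc <-] i j] /=.
  exists (mxvec Y); last exact: mxvecK.
  by move=> k /=; case/mxvec_indexP: k => i j; rewrite mxvecE in_itv /= -ler_norml.
have := vc (mxvec_index i j); rewrite /= in_itv /= -ler_norml.
by rewrite -{1}(vec_mxK v) mxvecE.
Qed.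

Lemma closed_eq_fun (T : topologicalType) (R : realType) (m n : nat)
    (f g : T -> 'M[R]_(m, n)) :
  continuous f -> continuous g -> closed [set t | f t = g t].
Proof.
move=> cf cg.
rewrite (_ : mkset _ = (fun t => f t - g t) @^-1` [set 0]); last first.
  by apply/seteqP; split=> t /= => [->|/eqP]; rewrite ?subrr// subr_eq0 => /eqP.
have cfg : continuous (fun t => f t - g t).
  by move=> t; apply: cvgB; [apply: cf | apply: cg].
apply: ((continuous_closedP _).1 cfg).
by apply: compact_closed; [exact: norm_hausdorff | exact: compact_set1].
Qed.

(** * Inner products and the bipolar theorem for closed cones *)

Lemma dotE (R : realType) (n : nat) (u v : 'cV[R]_n) :
  (u^T *m v) ord0 ord0 = \sum_i u i ord0 * v i ord0.
Proof. by rewrite mxE; apply: eq_bigr => i _; rewrite mxE. Qed.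

Lemma dotC (R : realType) (n : nat) (u v : 'cV[R]_n) :
  (u^T *m v) ord0 ord0 = (v^T *m u) ord0 ord0.
Proof. by rewrite !dotE; apply: eq_bigr => i _; rewrite mulrC. Qed.

Lemma entry_sqr_le_dot (R : realType) (n : nat) (u : 'cV[R]_n) i j :
  `|u i j| ^+ 2 <= (u^T *m u) ord0 ord0.
Proof.
rewrite dotE (bigD1 i)//= (ord1 j) real_normK ?num_real// expr2 lerDl.
by apply: sumr_ge0 => k _; rewrite -expr2 sqr_ge0.
Qed.

Lemma dot_ge0 (R : realType) (n : nat) (u : 'cV[R]_n) :
  0 <= (u^T *m u) ord0 ord0.
Proof. by rewrite dotE; apply: sumr_ge0 => k _; rewrite -expr2 sqr_ge0. Qed.

Lemma sqr_dot_addZ (R : realType) (n : nat) (z w : 'cV[R]_n) (t : R) :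
  ((z + t *: w)^T *m (z + t *: w)) ord0 ord0 =
  (z^T *m z) ord0 ord0 + t *+ 2 * (z^T *m w) ord0 ord0 +
  t ^+ 2 * (w^T *m w) ord0 ord0.
Proof.
rewrite !dotE 2!mulr_sumr -!big_split /=.
by apply: eq_bigr => i _; rewrite !mxE; ring.
Qed.

(** First-order optimality condition at a minimum of the squared norm: [a] is half the slope at
    [t = 0]. *)
Lemma ge0_of_quadratic (R : realType) (a b : R) : 0 <= b ->
  (forall t, 0 < t -> t <= 1 -> 0 <= t *+ 2 * a + t ^+ 2 * b) -> 0 <= a.
Proof.
move=> b0 h; rewrite leNgt; apply/negP => a0.
have ba : 0 < b - a by lra.
(* At [t = - a / (b - a)] the quadratic equals [t * (1 + t) * a], which is negative when [a] is. *)
have t0 : 0 < - a / (b - a) by rewrite divr_gt0// oppr_gt0.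
have t1 : - a / (b - a) <= 1 by rewrite ler_pdivrMr// mul1r; lra.
have := h _ t0 t1; move: t0 t1; set t := - a / (b - a) => t0 t1.
have tE : t * (b - a) = - a by rewrite /t divfK// gt_eqF.
have -> : t *+ 2 * a + t ^+ 2 * b = t * (a *+ 2 + t * a + t * (b - a)) by ring.
by rewrite tE pmulr_rge0//; nra.
Qed.

(* The separating functional is the difference between the point of [K] nearest
   to [x] and [x] itself. *)
Lemma closed_cone_bipolar (R : realType) (n : nat) (K : set 'cV[R]_n) x :
  convex_cone K -> closed K ->
  (forall s, dual_cone K s -> 0 <= (s^T *m x) ord0 ord0) -> K x.
Proof.
move=> [K0 KD KZ] clK xK.
pose f (z : 'cV[R]_n) : R := (z^T *m z) ord0 ord0.
(* Here [z] is a displacement from [x] and [f] its squared norm. Since [u <= 1 + u ^+ 2], the box of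
   size [c] contains [- x]; a displacement outside it has squared norm above
   [c ^+ 2 >= c > f (- x)]. Hence a minimum over the compact set [A] is a global one. *)
pose c := 1 + f (- x).
have f0 : 0 <= f (- x) by exact: dot_ge0.
pose A := [set z : 'cV[R]_n | forall i j, `|z i j| <= c] `&`
          [set z | K (z + x)].
have cid : continuous (fun z : 'cV[R]_n => z) by move=> z; exact: cvg_id.
have cA : compact A.
  apply: compact_closedI; first exact: mx_box_compact.
  have cx : continuous (fun z : 'cV[R]_n => z + x).
    by move=> z; exact: (cvgD (cid z) (cvg_cst x)).
  exact: ((continuous_closedP _).1 cx _ clK).
have AxN : A (- x).
  split=> [i j|]; last by rewrite /= addNr.
  have := entry_sqr_le_dot (- x) i j; rewrite -/(f _) /c; set u := `|_|.
  by have := sqr_ge0 (u - 1); nra.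
have cf : continuous f.
  apply: continuous_mx_entry; apply: continuous_mulmx => //.
  exact: continuous_trmx.
have [z /set_mem [_ /= Kzx] zmin'] :=
  compact_EVT_min (ex_intro _ _ AxN) cA (continuous_subspaceT cf).
have zmin w : K (w + x) -> f z <= f w.
  move=> Kw; have [wA|/existsNP[i /existsNP[j /negP]]] :=
    pselect (forall i j, `|w i j| <= c).
    by apply: zmin'; apply/mem_set.
  rewrite -ltNge => cw; apply: (le_trans (zmin' (- x) (mem_set AxN))).
  have := entry_sqr_le_dot w i j; rewrite -/(f _); move: cw; rewrite /c.
  by set u := `|_|; nra.
have quad w : (forall t, 0 < t -> t <= 1 -> K (z + t *: w + x)) ->
    0 <= (z^T *m w) ord0 ord0.
  move=> Kw; apply: (ge0_of_quadratic (dot_ge0 w)) => t t0 t1.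
  by have := zmin _ (Kw t t0 t1); rewrite /f sqr_dot_addZ; lra.
(* Moving from the nearest point [z + x] in a direction [y] of [K] stays in [K]. *)
have zK : dual_cone K z.
  by move=> y Ky; apply: quad => t t0 _; rewrite addrAC; apply: KD => //;
    apply: KZ => //; exact: ltW.
(* Moving from [z + x] towards the apex also stays in [K]. This bounds [z^T z] by [- z^T x], which
   is at most 0 because [z] is in the dual cone. *)
have zp : 0 <= (z^T *m (- (z + x))) ord0 ord0.
  apply: quad => t _ t1.
  rewrite (_ : _ + x = (1 - t) *: (z + x)).
    by apply: KZ => //; rewrite subr_ge0.
  by rewrite scalerN addrAC scalerBl scale1r.
have z0 : (z^T *m z) ord0 ord0 <= 0.
  have zpE : (z^T *m (- (z + x))) ord0 ord0 =
      - (z^T *m z) ord0 ord0 - (z^T *m x) ord0 ord0.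
    rewrite !dotE -!sumrN -big_split /=.
    by apply: eq_bigr => i _; rewrite !mxE; ring.
  by have := xK _ zK; lra.
suff -> : x = z + x by [].
rewrite (_ : z = 0) ?add0r//; apply/matrixP => i j; rewrite [RHS]mxE.
apply/eqP; rewrite -normr_eq0 -sqrf_eq0 eq_le sqr_ge0 andbT.
exact: le_trans (entry_sqr_le_dot z i j) z0.
Qed.

(** * The cone Q, its dual, and the inclusion of N(K) in N_0(K) *)

Lemma Qcone_coord (R : realType) (d : nat) (x : 'cV[R]_d.+1) i :
  @Qcone R d x -> 0 <= x i ord0 <= x ord0 ord0.
Proof.
pose C := [set y : 'cV[R]_d.+1 | 0 <= y i ord0 <= y ord0 ord0].
have CC : convex_cone C.
  split=> [|y z /= /andP[y0 y1] /andP[z0 z1]|a y a0 /= /andP[y0 y1]].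
  - by rewrite /C /= !mxE lexx.
  - by rewrite /C /= !mxE addr_ge0//= lerD.
  - by rewrite /C /= !mxE mulr_ge0//= ler_wpM2l.
suff QC : @Qcone R d `<=` C by exact: QC.
apply: smallest_sub => // z [z0 zi]; rewrite /C /= -!/(Defs.coord0 z) z0.
case: (unliftP ord0 i) => [j|] ->; last by rewrite -/(Defs.coord0 z) z0 ler01 lexx.
by rewrite -/(Defs.coord z j); case: (zi j) => ->; rewrite ?lexx ?ler01.
Qed.

Lemma dual_cone_subset (R : realType) (n : nat) (K L : set 'cV[R]_n) :
  K `<=` L -> dual_cone L `<=` dual_cone K.
Proof. by move=> KL s sL x /KL; exact: sL. Qed.

Lemma M_LS_monotone (R : realType) (d : nat) (K L : set 'cV[R]_d.+1) :
  K `<=` L -> M_LS K `<=` M_LS L.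
Proof.
move=> KL Y [YT Y0 YK]; split=> // u v uQ vL.
by apply: YK => //; exact: dual_cone_subset KL _ vL.
Qed.

Lemma N_LS_monotone (R : realType) (d : nat) (K L : set 'cV[R]_d.+1) :
  K `<=` L -> N_LS K `<=` N_LS L.
Proof. by move=> KL; apply: image_subset; exact: M_LS_monotone. Qed.

Lemma Nplus_LS_sub (R : realType) (d : nat) (K : set 'cV[R]_d.+1) :
  Nplus_LS K `<=` N_LS K.
Proof. by apply: image_subset => Y []. Qed.

Lemma unit_vec_dot (R : realType) (d : nat) j (x : 'cV[R]_d.+1) :
  ((unit_vec R j)^T *m x) ord0 ord0 = x j ord0.
Proof. by rewrite /unit_vec trmx_delta -rowE mxE. Qed.

Lemma unit_vec_dual (R : realType) (d : nat) j :
  dual_cone (@Qcone R d) (unit_vec R j).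
Proof. by move=> x /(Qcone_coord j) /andP[x0 _]; rewrite unit_vec_dot. Qed.

Lemma unit_vecB_dual (R : realType) (d : nat) j :
  dual_cone (@Qcone R d) (unit_vec R ord0 - unit_vec R j).
Proof.
move=> x /(Qcone_coord j) /andP[_ xj].
by rewrite raddfB /= mulmxBl [leRHS]mxE [X in _ + X]mxE !unit_vec_dot subr_ge0.
Qed.

(** By symmetry of [Y], the defining inequality says that [Y *m u] lies in the bidual of [K]. *)
Lemma M_LS_mulmx (R : realType) (d : nat) (K : set 'cV[R]_d.+1) Y u :
  convex_cone K -> closed K -> M_LS K Y -> dual_cone (@Qcone R d) u ->
  K (Y *m u).
Proof.
move=> cK clK [YT _ YK] uQ; apply: closed_cone_bipolar => // s sK.
by rewrite dotC trmx_mul YT; exact: YK.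
Qed.

Lemma N_LS_sub (R : realType) (d : nat) (K : set 'cV[R]_d.+1) :
  convex_cone K -> closed K -> N_LS K `<=` K.
Proof.
move=> cK clK _ [Y MY <-]; have [_ <- _] := MY.
by apply: M_LS_mulmx => //; exact: unit_vec_dual.
Qed.

Lemma N_LS_sub_N0_LS (R : realType) (d : nat) (K : set 'cV[R]_d.+1) :
  convex_cone K -> closed K -> N_LS K `<=` N0_LS K.
Proof.
move=> cK clK _ [Y MY <-] i _; have [YT Y0 _] := MY.
have YE k j : (Y *m unit_vec R j) k ord0 = Y k j by rewrite -colE mxE.
have Yd k : Y k ord0 = Y k k by rewrite -YE Y0 mxE.
(* Column 0 of [Y] is its diagonal, so with [j = lift ord0 i] coordinate [j] of this vector is
   [Y j 0 - Y j j = 0]. For the second summand [Y e_j], coordinates [j] and 0 are [Y j j] and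
   [Y 0 j], equal by symmetry. *)
exists (Y *m (unit_vec R ord0 - unit_vec R (lift ord0 i))).
  split; first by apply: M_LS_mulmx => //; exact: unit_vecB_dual.
  by rewrite /Defs.coord /= mulmxBr [LHS]mxE [X in _ + X]mxE !YE Yd subrr.
exists (Y *m unit_vec R (lift ord0 i)).
  split; first by apply: M_LS_mulmx => //; exact: unit_vec_dual.
  by rewrite /Defs.coord /Defs.coord0 /= !YE -Yd -[in LHS]YT mxE.
by rewrite -mulmxDr subrK Y0.
Qed.

(** * N(K) is a closed convex cone *)

Lemma N_LS_cone (R : realType) (d : nat) (K : set 'cV[R]_d.+1) :
  convex_cone (N_LS K).
Proof.
split=> [|_ _ [Y [YT Y0 YK] <-] [Z [ZT Z0 ZK] <-]|a _ a0 [Y [YT Y0 YK] <-]].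
- exists 0; last by apply/matrixP => i j; rewrite !mxE.
  split=> [||u v _ _]; first by rewrite trmx0.
    by rewrite mul0mx; apply/matrixP => i j; rewrite !mxE.
  by rewrite mulmx0 mul0mx mxE.
- exists (Y + Z); last by apply/matrixP => i j; rewrite !mxE.
  split=> [||u v uQ vK]; first by rewrite raddfD /= YT ZT.
    by rewrite mulmxDl Y0 Z0; apply/matrixP => i j; rewrite !mxE.
  by rewrite mulmxDr mulmxDl mxE addr_ge0// ?YK// ZK.
- exists (a *: Y); last by apply/matrixP => i j; rewrite !mxE.
  split=> [||u v uQ vK]; first by rewrite linearZ /= YT.
    by rewrite -scalemxAl Y0; apply/matrixP => i j; rewrite !mxE.
  by rewrite -scalemxAr -scalemxAl mxE mulr_ge0// YK.
Qed.

(** As [K] lies in Q, each [e_l] is in the dual of [K]. Pairing it with [e_k] gives [0 <= Y k l],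
    and with [e_0 - e_k] gives [Y k l <= Y 0 l]. The latter, used twice with symmetry, yields
    [Y i j <= Y 0 j = Y j 0 <= Y 0 0]. *)
Lemma M_LS_bound (R : realType) (d : nat) (K : set 'cV[R]_d.+1) Y i j :
  K `<=` @Qcone R d -> M_LS K Y -> 0 <= Y i j <= Y ord0 ord0.
Proof.
move=> KQ [YT _ YK].
have QK := dual_cone_subset KQ.
have entry k l : ((unit_vec R k)^T *m Y *m unit_vec R l) ord0 ord0 = Y k l.
  by rewrite -mulmxA unit_vec_dot -colE mxE.
have Y_ge0 k l : 0 <= Y k l.
  by rewrite -entry; apply: YK; [|apply: QK]; exact: unit_vec_dual.
have Y_le k l : Y k l <= Y ord0 l.
  rewrite -subr_ge0 -!entry.
  have := YK _ _ (unit_vecB_dual k) (QK _ (unit_vec_dual l)).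
  by rewrite raddfB /= !mulmxBl [X in 0 <= X -> _]mxE [X in 0 <= _ + X -> _]mxE.
rewrite Y_ge0 (le_trans (Y_le i j))//.
by have := Y_le j ord0; rewrite -{1}YT mxE.
Qed.

Lemma M_LS_closed (R : realType) (d : nat) (K : set 'cV[R]_d.+1) :
  closed (M_LS K).
Proof.
have cid : continuous (fun Y : 'M[R]_d.+1 => Y) by move=> Y; exact: cvg_id.
have ccst m n (A : 'M[R]_(m, n)) : continuous (fun _ : 'M[R]_d.+1 => A).
  exact: cst_continuous.
rewrite (_ : M_LS K = [set Y | Y^T = Y] `&`
    ([set Y | Y *m unit_vec R ord0 = diag_vec Y] `&`
    \bigcap_(uv in [set uv | dual_cone (@Qcone R d) uv.1 /\ dual_cone K uv.2])
      [set Y | 0 <= (uv.1^T *m Y *m uv.2) ord0 ord0])); last first.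
  apply/seteqP; split=> [Y [YT Y0 YK]|Y [YT [Y0 YK]]].
    by do 2![split=> //]; move=> [u v] [/= uQ vK]; exact: YK.
  by split=> // u v uQ vK; exact: (YK (u, v) (conj uQ vK)).
apply: closedI; first by apply: closed_eq_fun => //; exact: continuous_trmx.
apply: closedI.
  apply: closed_eq_fun; last exact: continuous_diag_vec.
  exact: continuous_mulmx.
apply: closed_bigI => -[u v] _ /=.
have cuv : continuous (fun Y : 'M[R]_d.+1 => (u^T *m Y *m v) ord0 ord0).
  by apply: continuous_mx_entry; apply: continuous_mulmx (ccst _ _ v);
    apply: continuous_mulmx cid.
exact: ((continuous_closedP _).1 cuv _ (@closed_ge R 0)).
Qed.

(* The entries of a member of [M_LS K] lie between 0 and [Y 0 0], so the part of
   [N_LS K] below any height is a continuous image of a compact set. *)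
Lemma N_LS_closed (R : realType) (d : nat) (K : set 'cV[R]_d.+1) :
  K `<=` @Qcone R d -> closed (N_LS K).
Proof.
move=> KQ x clx; pose c := x ord0 ord0 + 1.
pose A := [set Y : 'M[R]_d.+1 | forall i j, `|Y i j| <= c] `&` M_LS K.
have clA : closed (@diag_vec R _ @` A).
  apply: compact_closed; first exact: norm_hausdorff.
  apply: continuous_compact.
    by apply: continuous_subspaceT; exact: continuous_diag_vec.
  by apply: compact_closedI; [exact: mx_box_compact | exact: M_LS_closed].
suff [Y [_ MY] <-] : (@diag_vec R _ @` A) x by exists Y.
apply: clA => B Bx.
(* The slack 1 in [c] makes the points of height below [c] a neighbourhood of [x]; in it every point
   of [N_LS K] comes from [A]. *)
have Cx : nbhs x [set y : 'cV[R]_d.+1 | y ord0 ord0 < c].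
  have xc : nbhs (x ord0 ord0) [set a | a < c].
    by apply: open_nbhs_nbhs; split; [exact: open_lt | rewrite /c /= ltrDl].
  exact: (@coord_continuous R _ _ ord0 ord0 x _ xc).
have [_ [[Y MY <-] [BY CY]]] := clx _ (filterI Bx Cx).
exists (diag_vec Y); split=> //; exists Y => //; split=> // i j.
move: CY; rewrite /= mxE => /ltW; apply: le_trans.
by have /andP[Y0 Y1] := M_LS_bound i j KQ MY; rewrite ger0_norm.
Qed.

(** * Partition sums and one step of N_0 *)

Lemma N0_LS_monotone (R : realType) (d : nat) (K L : set 'cV[R]_d.+1) :
  K `<=` L -> N0_LS K `<=` N0_LS L.
Proof.
move=> KL x Kx i _; have [y [Ky yi] [z [Kz zi] <-]] := Kx i I.
by exists y; [split; [exact: KL|] | exists z => //; split; [exact: KL|]].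
Qed.

Lemma is_bipartitionP (d : nat) (J : {set 'I_d}) (P : {set 'I_d} * {set 'I_d}) :
  reflect (forall j, (j \in J) = (j \in P.1) || (j \in P.2) /\
                     ~~ ((j \in P.1) && (j \in P.2)))
          (is_bipartition J P).
Proof.
apply: (iffP andP) => [[/eqP <- /pred0P dP] j|h].
  by rewrite inE (dP j : _ && _ = _).
split; first by apply/eqP/setP => j; rewrite inE (h j).1.
by apply/pred0P => j; apply/negbTE; exact: (h j).2.
Qed.

(** The left side is the condition that arises when a sum is reindexed along
    [P |-> (i |: P.1, P.2)]; its second conjunct encodes that [i] is not in [P.1]. *)
Lemma is_bipartition_addl (d : nat) (J : {set 'I_d}) i P :
  i \in J -> is_bipartition J (i |: P.1, P.2) && (P.1 == P.1 :\ i) =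
             is_bipartition (J :\ i) P.
Proof.
move=> iJ; apply/andP/is_bipartitionP => [[/is_bipartitionP h /eqP P1] j|h].
  have [] := h j; rewrite /= P1 !inE; have [->|] //= := eqVneq j i.
  by rewrite iJ => _; case: (i \in P.2).
split.
  apply/is_bipartitionP => j /=; have [] := h j; rewrite !inE.
  by have [->|//] := eqVneq j i; rewrite /= iJ; case: (i \in P.1); case: (i \in P.2).
apply/eqP/setP => j; have [] := h j; rewrite !inE.
by have [->|//] := eqVneq j i; case: (i \in P.1).
Qed.

Lemma is_bipartition_swap (d : nat) (J A B : {set 'I_d}) :
  is_bipartition J (A, B) = is_bipartition J (B, A).
Proof. by rewrite /is_bipartition /= finset.setUC disjoint_sym. Qed.

Lemma is_bipartition_addr (d : nat) (J : {set 'I_d}) i P :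
  i \in J -> is_bipartition J (P.1, i |: P.2) && (P.2 == P.2 :\ i) =
             is_bipartition (J :\ i) P.
Proof.
case: P => A B iJ.
by rewrite /= is_bipartition_swap (is_bipartition_addl (B, A) iJ) is_bipartition_swap.
Qed.

(** Each partition of [J] puts [i] in exactly one part, and deleting [i] leaves a partition of
    [J :\ i]. *)
Lemma sum_bipartition (V : nmodType) (d : nat) (J : {set 'I_d}) i
    (F : {set 'I_d} * {set 'I_d} -> V) :
  i \in J ->
  \sum_(P | is_bipartition J P) F P =
    \sum_(P | is_bipartition (J :\ i) P) F (i |: P.1, P.2) +
    \sum_(P | is_bipartition (J :\ i) P) F (P.1, i |: P.2).
Proof.
move=> iJ; rewrite (bigID (fun P : {set 'I_d} * {set 'I_d} => i \in P.1)) /=; congr (_ + _).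
  rewrite (reindex_onto (fun P => (i |: P.1, P.2)) (fun P => (P.1 :\ i, P.2))).
    apply: eq_bigl => -[A B]; rewrite -(is_bipartition_addl (A, B) iJ) /=.
    rewrite finset.setU11 andbT xpair_eqE eqxx andbT; congr (_ && _).
    by rewrite finset.setDUl finset.setDv finset.set0U eq_sym.
  by move=> [A B] /andP[_ iA]; rewrite /= finset.setD1K.
rewrite (reindex_onto (fun P => (P.1, i |: P.2)) (fun P => (P.1, P.2 :\ i))).
  apply: eq_bigl => -[A B]; rewrite -(is_bipartition_addr (A, B) iJ) /=.
  rewrite xpair_eqE eqxx /= finset.setDUl finset.setDv finset.set0U eq_sym.
  (* The remaining condition that [i] is not in [A] follows from disjointness of [A] and
     [i |: B]. *)
  case JAB: (is_bipartition _ _) => //=.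
  have [_] := is_bipartitionP _ _ JAB i.
  by rewrite /= !inE eqxx andbT => ->.
move=> [A B] /andP[/is_bipartitionP/(_ i)[] /=]; rewrite iJ => + _ /negbTE iA.
by rewrite iA /= => iB; rewrite finset.setD1K.
Qed.

(** The empty set has a single partition, and its face imposes no condition. *)
Lemma N0tilde_LS0 (R : realType) (d : nat) (K : set 'cV[R]_d.+1) :
  K `<=` N0tilde_LS 0 K.
Proof.
move=> x Kx J /cards0_eq ->; exists (fun=> x).
  move=> P /is_bipartitionP h; split=> //.
  by split=> j; have [] := h j; rewrite inE; case: (j \in P.1); case: (j \in P.2).
rewrite (big_pred1 (finset.set0, finset.set0)) // => -[A B] /=.
apply/is_bipartitionP/eqP => [h|[-> ->] j]; last by rewrite !inE.
congr (_, _); apply/setP => j; have [] := h j; rewrite /= inE.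
  by case: (j \in A).
by case: (j \in B); rewrite ?orbT.
Qed.

Lemma cards_setD1 (T : finType) (A : {set T}) x r :
  x \in A -> #|A| = r.+1 -> #|A :\ x| = r.
Proof. by move=> xA; rewrite (cardsD1 x) xA => -[]. Qed.

Lemma N0_LS_N0tilde (R : realType) (d r : nat) (K : set 'cV[R]_d.+1) :
  K `<=` @Qcone R d -> N0_LS (N0tilde_LS r K) `<=` N0tilde_LS r.+1 K.
Proof.
move=> KQ x Nx J /= cJ.
have [i iJ] : exists i, i \in J by apply/set0Pn; rewrite -card_gt0 cJ.
have cJi : #|J :\ i| = r by exact: cards_setD1.
have [y [Ny yi] [z [Nz zi] <-]] := Nx i I.
have [f fK yE] := Ny _ cJi; have [g gK zE] := Nz _ cJi.
(* Nonnegative terms whose sum is 0 all vanish; [gi] applies this to the differences [x_0 - x_i]. *)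
have fi P : is_bipartition (J :\ i) P -> Defs.coord (f P) i = 0.
  move: P; apply: (psumr_eq0P (F := fun P => Defs.coord (f P) i)) => [P /fK[/KQ /Qcone_coord fQ _]|].
    by have /andP[] := fQ (lift ord0 i).
  by move: yi; rewrite /= yE /Defs.coord summxE.
have gi P : is_bipartition (J :\ i) P ->
    Defs.coord (g P) i = Defs.coord0 (g P).
  move=> JP; apply/eqP; rewrite eq_sym -subr_eq0; apply/eqP.
  move: P JP.
  apply: (psumr_eq0P (F := fun P => Defs.coord0 (g P) - Defs.coord (g P) i)) => [P /gK[/KQ /Qcone_coord gQ _]|].
    by have /andP[_] := gQ (lift ord0 i); rewrite subr_ge0.
  by move: zi; rewrite /= sumrB zE /Defs.coord /Defs.coord0 !summxE => ->; rewrite subrr.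
(* The part containing [i] decides whether the summand for [P] comes from [y] or from [z]. *)
pose h (P : {set 'I_d} * {set 'I_d}) :=
  if i \in P.1 then f (P.1 :\ i, P.2) else g (P.1, P.2 :\ i).
exists h; last first.
  rewrite (sum_bipartition _ iJ) yE zE; congr (_ + _); apply: eq_bigr => -[A B].
    move/is_bipartitionP/(_ i) => /= [].
    by rewrite /h /= finset.setU11 !inE eqxx /= => /esym /norP[iA _] _; rewrite finset.setU1K.
  move/is_bipartitionP/(_ i) => /= [].
  by rewrite /h /= !inE eqxx /= => /esym /norP[iA iB] _; rewrite (negbTE iA) finset.setU1K.
move=> [A B] JAB; rewrite /h /=.
have := JAB; move=> /is_bipartitionP/(_ i) /= []; rewrite iJ.
have [iA _ iB|iA /esym /= iB _] := boolP (i \in A).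
  have JP : is_bipartition (J :\ i) (A :\ i, B).
    by rewrite -is_bipartition_addl//= finset.setD1K// JAB; apply/eqP/setP=> j; rewrite !inE; case: eqP.
  have [fKP [f0 f1]] := fK _ JP; split=> //; split=> // j jA.
  by have [->|ji] := eqVneq j i; [exact: fi | apply: f0; rewrite !inE ji].
have JP : is_bipartition (J :\ i) (A, B :\ i).
  by rewrite -is_bipartition_addr//= finset.setD1K// JAB; apply/eqP/setP=> j; rewrite !inE; case: eqP.
have [gKP [g0 g1]] := gK _ JP; split=> //; split=> // j jB.
by have [->|ji] := eqVneq j i; [exact: gi | apply: g1; rewrite !inE ji].
Qed.

(** * Iterating the one-step inclusions *)

Lemma iter_Nplus_LS_sub (R : realType) (d r : nat) (K : set 'cV[R]_d.+1) :
  iter r (@Nplus_LS R d) K `<=` iter r (@N_LS R d) K.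
Proof.
elim: r => //= r IHr; apply: subset_trans (@Nplus_LS_sub _ _ _) _.
exact: N_LS_monotone.
Qed.

(** The three properties are carried jointly: containment in Q makes the next iterate closed, and a
    closed cone contains its image under N, which preserves containment in Q. *)
Lemma iter_N_LS_closed_cone (R : realType) (d r : nat) (K : set 'cV[R]_d.+1) :
  convex_cone K -> closed K -> K `<=` @Qcone R d ->
  [/\ convex_cone (iter r (@N_LS R d) K), closed (iter r (@N_LS R d) K) &
      iter r (@N_LS R d) K `<=` @Qcone R d].
Proof.
move=> cK clK KQ; elim: r => //= r [cN clN NQ].
split; [exact: N_LS_cone | exact: N_LS_closed |].
exact: subset_trans (N_LS_sub cN clN) NQ.
Qed.

Lemma iter_N_LS_sub (R : realType) (d r : nat) (K : set 'cV[R]_d.+1) :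
  convex_cone K -> closed K -> K `<=` @Qcone R d ->
  iter r (@N_LS R d) K `<=` iter r (@N0_LS R d) K.
Proof.
move=> cK clK KQ; elim: r => //= r IHr.
have [cN clN _] := iter_N_LS_closed_cone r cK clK KQ.
by apply: subset_trans (N_LS_sub_N0_LS cN clN) _; exact: N0_LS_monotone.
Qed.

Lemma iter_N0_LS_sub (R : realType) (d r : nat) (K : set 'cV[R]_d.+1) :
  K `<=` @Qcone R d -> iter r (@N0_LS R d) K `<=` N0tilde_LS r K.
Proof.
move=> KQ; elim: r => [|r IHr] /=; first exact: N0tilde_LS0.
by apply: subset_trans (N0_LS_N0tilde KQ); exact: N0_LS_monotone.
Qed.

Theorem theorem3p4 (R : realType) (d : nat) (hd : (1 <= d)%N)
    (K : set 'cV[R]_d.+1) (hK : convex_cone K) (hKQ : K `<=` @Qcone R d)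
    (r : nat) (hr : (r <= d)%N) :
  [/\ iter r (@Nplus_LS R d) K `<=` iter r (@N_LS R d) K,
      (closed K -> iter r (@N_LS R d) K `<=` iter r (@N0_LS R d) K) &
      iter r (@N0_LS R d) K `<=` N0tilde_LS r K].
Proof.
split; [exact: iter_Nplus_LS_sub | | exact: iter_N0_LS_sub].
by move=> clK; exact: iter_N_LS_sub.
Qed.
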